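(* Let $G$ be a connected graph on $n$ vertices with resistance deviations $\delta_1,\dots,\delta_n$ and resistance deviation operator $T$. Let $\alpha_1<\cdots<\alpha_k$ be the distinct values among $\delta_1,\dots,\delta_n$, where $\alpha_i$ occurs with multiplicity $m_i$, and let $I_i=\{j\in\{1,\dots,n\}:\delta_j=\alpha_i\}$. Then $T\mathbf 1=\mathbf 0$. Moreover, for each $i$, the set \[ E_i=\{x\in\mathbb R^n:\operatorname{supp}(x)\subseteq I_i,\ \mathbf 1^\top x=0\} \] is precisely the set of solutions $x\in\mathbf 1^\perp$ of $Tx=\alpha_i x$, and $\dim E_i=m_i-1$. The remaining $k-1$ eigenvalues of $T|_{\mathbf 1^\perp}$ are simple and are precisely the roots of \[ f(\lambda)=\sum_{j=1}^n\frac1{\delta_j-\lambda}=\sum_{i=1}^k\frac{m_i}{\alpha_i-\lambda}. \] For each $i\in\{1,\dots,k-1\}$, exactly one such root lies in $(\alpha_i,\alpha_{i+1})$. Together with the eigenvalue $0$ corresponding to $\mathbf 1$, these eigenvalues (the $\alpha_i$ with eigenspaces $E_i$ in $\mathbf 1^\perp$ and the $k-1$ roots of $f$) constitute the entire spectrum of $T$.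
   Context: $G=(V,E)$ is a finite, simple, connected, undirected, unweighted graph with vertex set $V=\{1,\dots,n\}$. $L=D_G-A$ is its combinatorial Laplacian (degree matrix minus adjacency matrix). $\mathbf 1\in\mathbb R^n$ is the all-ones vector, $I$ the identity matrix, $J=\mathbf 1\mathbf 1^\top$, $P=I-\frac1n J$. $L^\dagger$ is the Moore--Penrose inverse of $L$, i.e. the unique symmetric matrix with $LL^\dagger=L^\dagger L=I-\frac1n\mathbf 1\mathbf 1^\top$ and $L^\dagger\mathbf 1=\mathbf 0$. Put $d_i=(L^\dagger)_{ii}$, $D=\operatorname{diag}(d_1,\dots,d_n)$, $\bar d=\frac1n\operatorname{tr}(L^\dagger)$, and $\Delta=D-\bar d I$ (resistance deviation matrix), whose diagonal entries $\delta_1,\dots,\delta_n$ are the resistance deviations. The resistance deviation operator is the (symmetric) matrix $T=\Delta P+P\Delta-\Delta$. The support of $x$ is $\operatorname{supp}(x)=\{j:x_j\ne0\}$. The subspace $\mathbf 1^\perp$ is $T$-invariant and $T|_{\mathbf 1^\perp}$ is the restriction. *)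

(* Defs.v *)
From mathcomp Require Export all_boot all_order all_algebra.
From mathcomp Require Export reals.

Export Order.TTheory GRing.Theory Num.Theory.
Export passmx.

#[export] Set Implicit Arguments.
#[export] Unset Strict Implicit.
#[export] Unset Printing Implicit Defensive.

Local Open Scope ring_scope.

Section Laplacian.
Variables (R : realType) (n : nat).

Definition ones : 'cV[R]_n := const_mx 1.
Definition allones : 'M[R]_n := ones *m ones^T.
Definition ctrmx : 'M[R]_n := 1%:M - n%:R^-1 *: allones.

Definition adjmx (e : rel 'I_n) : 'M[R]_n := \matrix_(i, j) (e i j)%:R.
Definition degmx (e : rel 'I_n) : 'M[R]_n :=
  diag_mx (\row_i #|[set j | e i j]|%:R).
Definition laplacian (e : rel 'I_n) : 'M[R]_n := degmx e - adjmx e.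

(* [X] is the Moore-Penrose inverse of the Laplacian of a connected graph;
   [lap_pinv_exists], [lap_pinv_unique] and [lap_pinv_penrose] show that this
   determines [X] and implies the four Penrose equations. *)
Definition is_lap_pinv (e : rel 'I_n) (X : 'M[R]_n) : Prop :=
  [/\ X^T = X, laplacian e *m X = ctrmx, X *m laplacian e = ctrmx
    & X *m ones = 0].

End Laplacian.

Arguments ones {R n}.
Arguments allones {R n}.
Arguments ctrmx {R n}.
Arguments adjmx R {n} e.
Arguments degmx R {n} e.
Arguments laplacian R {n} e.

(* In this section [Ld] stands for the Moore-Penrose inverse. *)
Section ResistanceDeviation.
Variables (R : realType) (n : nat) (Ld : 'M[R]_n).

Definition dmx : 'M[R]_n := diag_mx (\row_i Ld i i).
Definition dbar : R := n%:R^-1 * \tr Ld.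
Definition devmx : 'M[R]_n := dmx - dbar%:M.
Definition dev (j : 'I_n) : R := devmx j j.
Definition rdop : 'M[R]_n := devmx *m ctrmx + ctrmx *m devmx - devmx.

(* Increasing list of the distinct resistance deviations, indexed from 0. *)
Definition devs : seq R := sort <=%R (undup [seq dev j | j <- enum 'I_n]).

Definition dev_class (i : nat) : {set 'I_n} := [set j | dev j == devs`_i].

Definition supp (x : 'cV[R]_n) : {set 'I_n} := [set j | x j 0 != 0].

Definition dev_space (i : nat) (x : 'cV[R]_n) : Prop :=
  supp x \subset dev_class i /\ ones^T *m x = 0.

Definition secular (lambda : R) : R := \sum_(j < n) (dev j - lambda)^-1.

(* The poles have to be excluded by hand, since [0^-1 = 0]. *)
Definition secular_root (lambda : R) : Prop :=
  (forall j, dev j != lambda) /\ secular lambda = 0.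

Definition onesperp : {vspace 'cV[R]_n} :=
  lker (linfun (mulmx (ones^T : 'rV[R]_n))).

(* The restriction of [rdop] to [onesperp]; the projection [vsproj] only
   serves to cast back into the subspace (see [val_rdop_perp]). *)
Definition rdop_perp : 'End(subvs_of onesperp) :=
  linfun (vsproj onesperp \o (mulmx rdop \o vsval)).

End ResistanceDeviation.

Definition has_dim (K : fieldType) (vT : vectType K) (S : vT -> Prop)
    (d : nat) : Prop :=
  exists U : {vspace vT}, (forall x, x \in U <-> S x) /\ \dim U = d.

(* The characteristic polynomial of an endomorphism, in an arbitrary basis. *)
Definition lchar_poly (K : fieldType) (vT : vectType K) (g : 'End(vT)) :
    {poly K} :=
  char_poly (mxof (vbasis {:vT}) (vbasis {:vT}) g).

(* Algebraic and geometric multiplicity one. *)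
Definition simple_eigenvalue (K : fieldType) (vT : vectType K) (g : 'End(vT))
    (a : K) : Prop :=
  \dim (leigenspace g a) = 1%N /\ mup a (lchar_poly g) = 1%N.

Section LapPinvFacts.
Variables (R : realType) (n : nat).
Implicit Types (e : rel 'I_n) (X Y : 'M[R]_n).

Lemma lap_ones e : laplacian R e *m ones = 0.
Proof.
apply/colP => i; rewrite mulmxBl !mxE.
rewrite (bigD1 i) //= [X in _ + X - _]big1 => [|j /negPf ji]; last first.
  by rewrite !mxE eq_sym ji mulr0n mul0r.
rewrite !mxE eqxx addr0 mulr1 mulr1n -sum1_card natr_sum.
apply/eqP; rewrite subr_eq0; apply/eqP.
rewrite big_mkcond /=; apply: eq_bigr => j _.
by rewrite !mxE inE mulr1; case: (e i j).
Qed.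

Lemma lap_sym e : symmetric e -> (laplacian R e)^T = laplacian R e.
Proof.
move=> es; rewrite linearB /= /degmx tr_diag_mx; congr (_ - _).
by apply/matrixP => i j; rewrite !mxE es.
Qed.

Lemma ones_lap e : symmetric e -> ones^T *m laplacian R e = 0.
Proof. by move=> es; rewrite -[LHS]trmxK trmx_mul trmxK lap_sym// lap_ones trmx0. Qed.

Lemma lap_pinv_penrose e X : is_lap_pinv e X ->
  let L := laplacian R e in
  [/\ L *m X *m L = L, X *m L *m X = X,
      (L *m X)^T = L *m X & (X *m L)^T = X *m L].
Proof.
move=> [Xs LX XL X1] /=.
have cs : ctrmx^T = ctrmx :> 'M[R]_n.
  by rewrite /ctrmx linearB linearZ /= trmx1 /allones trmx_mul trmxK.
split; [| | by rewrite LX cs | by rewrite XL cs].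
  rewrite -mulmxA XL /ctrmx mulmxBr mulmx1 -scalemxAr /allones mulmxA.
  by rewrite lap_ones mul0mx scaler0 subr0.
rewrite -mulmxA LX /ctrmx mulmxBr mulmx1 -scalemxAr /allones mulmxA.
by rewrite X1 mul0mx scaler0 subr0.
Qed.

Lemma lap_pinv_unique e X Y : is_lap_pinv e X -> is_lap_pinv e Y -> X = Y.
Proof.
move=> hX hY; have [_ XLX _ _] := lap_pinv_penrose hX.
have [_ YLY _ _] := lap_pinv_penrose hY.
case: hX hY => [_ LX XL _] [_ LY YL _].
by rewrite -XLX XL -YL -mulmxA LX -LY mulmxA.
Qed.

Lemma lap_quad e (x : 'cV[R]_n) : symmetric e ->
  (x^T *m (laplacian R e *m x)) 0 0 *+ 2 =
  \sum_i \sum_j (e i j)%:R * (x i 0 - x j 0) ^+ 2.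
Proof.
move=> es.
have Lx i : (laplacian R e *m x) i 0 = \sum_j (e i j)%:R * (x i 0 - x j 0).
  rewrite mulmxBl mul_diag_mx !mxE -sum1_card natr_sum big_mkcond /=.
  rewrite mulr_suml -sumrB; apply: eq_bigr => j _.
  by rewrite !mxE inE mulrBr; case: (e i j).
rewrite mxE mulr2n.
transitivity (\sum_i \sum_j x i 0 * ((e i j)%:R * (x i 0 - x j 0)) +
              \sum_i \sum_j x j 0 * ((e i j)%:R * (x j 0 - x i 0))).
  congr (_ + _); last rewrite exchange_big /=; apply: eq_bigr => i _;
    rewrite mxE Lx mulr_sumr //; apply: eq_bigr => j _; by rewrite [e i j]es.
rewrite -big_split; apply: eq_bigr => i _; rewrite -big_split /=.
apply: eq_bigr => j _; rewrite expr2 !mulrA ![x _ 0 * _]mulrC -!mulrA -mulrDr.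
by congr (_ * _); rewrite -[x j 0 - x i 0]opprB mulrN -mulrBl.
Qed.

Lemma lap_pinv_exists e : (0 < n)%N -> symmetric e ->
  (forall i j, connect e i j) -> exists X : 'M[R]_n, is_lap_pinv e X.
Proof.
move=> n0 es ec; pose L := laplacian R e.
have nN0 : n%:R != 0 :> R by rewrite pnatr_eq0 -lt0n.
pose Q : 'M[R]_n := n%:R^-1 *: allones.
have o11 : (ones : 'cV[R]_n)^T *m ones = n%:R%:M.
  apply/matrixP => i j; rewrite !ord1 !mxE.
  under eq_bigr do rewrite !mxE mulr1.
  by rewrite sumr_const card_ord.
have Q1 : Q *m ones = ones.
  by rewrite -scalemxAl /allones -mulmxA o11 mul_mx_scalar scalerA mulVf// scale1r.
have LQ : L *m Q = 0 by rewrite -scalemxAr mulmxA lap_ones mul0mx scaler0.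
have QL : Q *m L = 0 by rewrite -scalemxAl -mulmxA ones_lap// mulmx0 scaler0.
have QQ : Q *m Q = Q by rewrite {2 3}/Q -scalemxAr mulmxA Q1.
have Qs : Q^T = Q by rewrite linearZ /= /allones trmx_mul trmxK.
have Ls : L^T = L by exact: lap_sym.
have Bs : (L + Q)^T = L + Q by rewrite linearD /= Qs Ls.
have Bu : L + Q \in unitmx.
  rewrite -unitmx_tr -row_free_unit -kermx_eq0; apply/eqP/row_matrixP => i.
  rewrite row0 -[LHS]trmxK; set x := (row _ _)^T.
  have Bx : (L + Q) *m x = 0.
    by rewrite -[LHS]trmxK trmx_mul trmxK -row_mul mulmx_ker row0 trmx0.
  move: x Bx => x Bx.
  have Qx : Q *m x = 0.
    by rewrite -[Q]add0r -QL -{2}QQ -mulmxDr -mulmxA Bx mulmx0.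
  have Lx : L *m x = 0 by have := Bx; rewrite mulmxDl Qx addr0.
  have := lap_quad x es; rewrite -/L Lx mulmx0 mxE mul0rn => /esym.
  have t0 a b : 0 <= (e a b)%:R * (x a 0 - x b 0) ^+ 2.
    by rewrite mulr_ge0 ?ler0n ?sqr_ge0.
  move/psumr_eq0P => xx; have {}xx a b : e a b -> x a 0 = x b 0.
    move=> eab; have /psumr_eq0P /(_ b isT) : \sum_b (e a b)%:R * (x a 0 - x b 0) ^+ 2 = 0.
      by apply: xx => // c _; exact: sumr_ge0.
    rewrite eab mul1r => /(_ (fun c _ => t0 a c)) /eqP.
    by rewrite sqrf_eq0 subr_eq0 => /eqP.
  have xc a b : x a 0 = x b 0.
    have /connectP[p] := ec a b; elim: p a => [a _ ->//|c p IH a /= /andP[eac pc] bl].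
    by rewrite (xx _ _ eac); exact: IH.
  have xE : x = x (Ordinal n0) 0 *: ones.
    by apply/colP => a; rewrite !mxE mulr1; exact: xc.
  suff -> : x = 0 by rewrite trmx0.
  by move: Qx; rewrite xE -scalemxAr Q1.
have BQ : (L + Q) *m Q = Q by rewrite mulmxDl LQ QQ add0r.
have QB : Q *m (L + Q) = Q by rewrite mulmxDr QL QQ add0r.
have VQ : invmx (L + Q) *m Q = Q by rewrite -[RHS](mulKmx Bu) BQ.
have QV : Q *m invmx (L + Q) = Q by rewrite -[RHS](mulmxK Bu) QB.
have LE : L = (L + Q) - Q by rewrite addrK.
exists (invmx (L + Q) - Q); split.
- by rewrite linearB /= trmx_inv Bs Qs.
- by rewrite mulmxBr -/L LQ subr0 [X in X *m _]LE mulmxBl mulmxV// QV.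
- by rewrite mulmxBl -/L QL subr0 [X in _ *m X]LE mulmxBr mulVmx// VQ.
- by rewrite mulmxBl Q1 -[X in _ *m X - _]Q1 mulmxA VQ Q1 subrr.
Qed.

End LapPinvFacts.

Section PerpFacts.
Variables (R : realType) (n : nat) (Ld : 'M[R]_n).

Lemma memv_onesperp (x : 'cV[R]_n) :
  (x \in onesperp R n) = (ones^T *m x == 0).
Proof. by rewrite memv_ker lfunE. Qed.

Lemma val_rdop_perp (u : subvs_of (onesperp R n)) :
  (0 < n)%N -> vsval (rdop_perp Ld u) = rdop Ld *m vsval u.
Proof.
move=> n0; rewrite lfunE /= vsprojK// memv_onesperp.
have nN0 : n%:R != 0 :> R by rewrite pnatr_eq0 -lt0n.
have o11 : (ones : 'cV[R]_n)^T *m ones = n%:R%:M.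
  apply/matrixP => i j; rewrite !ord1 !mxE.
  under eq_bigr do rewrite !mxE mulr1.
  by rewrite sumr_const card_ord.
have /eqP u1 : ones^T *m vsval u == 0 by rewrite -memv_onesperp subvsP.
have cu : ctrmx *m vsval u = vsval u.
  by rewrite mulmxBl mul1mx -scalemxAl -mulmxA u1 mulmx0 scaler0 subr0.
have oc : ones^T *m ctrmx = 0 :> 'rV[R]_n.
  rewrite mulmxBr mulmx1 -scalemxAr mulmxA o11 mul_scalar_mx scalerA.
  by rewrite mulVf// scale1r subrr.
have -> : rdop Ld *m vsval u = ctrmx *m (devmx Ld *m vsval u).
  rewrite /rdop mulmxBl mulmxDl -[devmx Ld *m ctrmx *m _]mulmxA cu.
  by rewrite addrAC subrr add0r mulmxA.
by rewrite mulmxA oc mul0mx.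
Qed.

End PerpFacts.

(* Main.v *)
Require Import Defs.
From mathcomp Require Import ring polyrcf.

Local Open Scope ring_scope.

(** For [x] orthogonal to [ones], the operator [T] is multiplication by the
    deviations followed by centering: [(T x)_j = dev j * x_j - c], where [c] is
    the mean of the [dev j * x_j]. Hence [T x = a x] if and only if the numbers
    [(dev j - a) * x_j] are all equal to one constant [c] ([rdop_eigenP]).

    If [a] is one of the deviations [alpha_i], then [c = 0], and [x] is any
    vector that sums to 0 and is supported on the vertices of deviation
    [alpha_i]; these form a space of dimension [m_i - 1] ([dev_space_eigenP],
    [dim_dev_space]). If [a] is not a deviation, then [x_j = c / (dev j - a)],
    and the condition that [x] sums to 0 is the secular equation
    ([leigenvalue_rdop_perpP]).

    The secular function is [- p' / p] for [p = \prod_j ('X - dev j)]. Rolle's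
    theorem yields a root of it between any two consecutive distinct deviations
    ([secular_root_gap]); it increases on such a gap, so this root is unique
    ([secular_root_gap_unique]), and by signs there is no root outside the gaps
    ([secular_root_in_gap]). With [k] distinct deviations there are exactly
    [k - 1] roots.

    The eigenspaces obtained in this way have total dimension at least
    [(n - k) + (k - 1) = n - 1], which is the dimension of the orthogonal
    complement of [ones]. A power ['X - a] with exponent the dimension of the
    eigenspace of [a] divides the characteristic polynomial, so a comparison of
    degrees determines this polynomial completely ([lchar_poly_eigenvalues]),
    and with it the multiplicities. Finally [T] is the direct sum of its
    restriction and of 0 on the line of [ones] ([char_poly_rdop]), which gives
    the entire spectrum. *)

(** * Characteristic polynomials and dimensions of eigenspaces *)

(** Turns abstract vectors into the rows of a matrix without losing their
    independence: a relation between the rows is the image of one between the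
    vectors. *)
Lemma row_free_free_tuple (K : fieldType) (vT : vectType K) (p n : nat)
    (f : {linear vT -> 'rV[K]_n}) (X : p.-tuple vT) :
  injective f -> free X -> row_free (\matrix_(i < p) f X`_i).
Proof.
move=> f_inj /freeP X_free; rewrite -kermx_eq0.
apply/eqP/row_matrixP => i; rewrite row0; set c := row i _.
have : c *m (\matrix_(i < p) f X`_i) = 0 by rewrite -row_mul mulmx_ker row0.
rewrite mulmx_sum_row => cX0.
have /f_inj/X_free c0 : f (\sum_(j < p) c 0 j *: X`_j) = f 0.
  rewrite linear0 linear_sum -[RHS]cX0; apply: eq_bigr => j _.
  by rewrite linearZ rowK.
by apply/rowP => j; rewrite c0 mxE.
Qed.

(** Geometric multiplicity is at most algebraic multiplicity. Gaussian
    elimination writes [M - a] as [U *m pid_mx r *m V] with [U], [V] invertible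
    and [r] its rank, so that ['X - M] is [U *m Z *m V] with
    [Z = ('X - a) *: (U^-1 *m V^-1) - pid_mx r]. The last [n - r] rows of [Z]
    are multiples of ['X - a], and they contribute the power of ['X - a] to the
    determinant. *)
Lemma dvdp_char_poly_eigenspace (K : fieldType) (n : nat) (M : 'M[K]_n)
    (a : K) :
  ('X - a%:P) ^+ \rank (eigenspace M a) %| char_poly M.
Proof.
rewrite mxrank_ker; set N := M - a%:M; set r := \rank N.
have N_ebase : col_ebase N *m pid_mx r *m row_ebase N = N by exact: mulmx_ebase.
move: (col_ebase_unit N) (row_ebase_unit N) N_ebase.
move: (col_ebase N) (row_ebase N) => U V U_unit V_unit N_ebase.
pose W := map_mx polyC (invmx U *m invmx V).
pose w (i : 'I_n) : {poly K} := if (i < r)%N then 1 else 'X - a%:P.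
pose Q : 'M[{poly K}]_n := \matrix_(i, j)
  if (i < r)%N then ('X - a%:P) * W i j - (pid_mx r : 'M_n) i j else W i j.
(* [diag_mx (\row_i w i)] collects the factors ['X - a] of those rows of [Z]. *)
have charE : char_poly_mx M =
    map_mx polyC U *m (diag_mx (\row_i w i) *m Q) *m map_mx polyC V.
  have -> : diag_mx (\row_i w i) *m Q = ('X - a%:P) *: W - pid_mx r.
    apply/matrixP => i j; rewrite mul_diag_mx !mxE /w.
    case: ifP => [_|i_ge]; first by rewrite mul1r.
    by rewrite andbF subr0.
  rewrite mulmxBr mulmxBl -scalemxAr -scalemxAl.
  have -> : map_mx polyC U *m W *m map_mx polyC V = 1%:M.
    by rewrite -!map_mxM mulKVmx // mulVmx // map_mx1.
  rewrite -(map_pid_mx polyC) -!map_mxM N_ebase /N map_mxB map_scalar_mx /=.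
  by rewrite scalemx1 /char_poly_mx raddfB /= opprB addrA subrK.
rewrite /char_poly charE !det_mulmx det_diag.
have -> : \prod_(i < n) (\row_i w i) 0 i = ('X - a%:P) ^+ (n - r).
  under eq_bigr do rewrite mxE.
  rewrite -(big_mkord xpredT (fun i => if (i < r)%N then 1 else 'X - a%:P)).
  rewrite (big_cat_nat (n := r)) ?rank_leq_row //=.
  rewrite big_nat big1 => [|i /andP[_ ->] //]; rewrite mul1r.
  rewrite big_nat; under eq_bigr => i /andP[i_ge _] do rewrite ltnNge i_ge /=.
  by rewrite -big_nat prodr_const_nat.
by rewrite dvdp_mulr // dvdp_mull // dvdp_mulr.
Qed.

(** Similarity for formats that are only provably equal: the dimension of a
    subspace never is syntactically [n], so the equation [p = n] is kept as a
    hypothesis and no cast appears. *)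
Lemma char_poly_intertwine (K : fieldType) (p n : nat) (S : 'M[K]_(p, n))
    (M : 'M[K]_n) (N : 'M[K]_p) :
  p = n -> row_free S -> S *m M = N *m S -> char_poly M = char_poly N.
Proof.
move=> pn; subst p; rewrite row_free_unit unitmxE unitfE => S_det SM.
have comm :
    map_mx polyC S *m char_poly_mx M = char_poly_mx N *m map_mx polyC S.
  by rewrite mulmxBr mulmxBl mul_mx_scalar mul_scalar_mx -!map_mxM SM.
have := congr1 determinant comm; rewrite !det_mulmx mulrC det_map_mx.
by apply: mulIf; rewrite polyC_eq0.
Qed.

Section LinearCharPoly.
Variables (K : fieldType) (vT : vectType K) (g : 'End(vT)).

Lemma size_lchar_poly : size (lchar_poly g) = (\dim {:vT}).+1.
Proof. exact: size_char_poly. Qed.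

Lemma lchar_poly_monic : lchar_poly g \is monic.
Proof. exact: char_poly_monic. Qed.

Lemma leigenspaceP a x : reflect (g x = a *: x) (x \in leigenspace g a).
Proof.
rewrite memv_ker !lfunE /= opp_lfunE scale_lfunE id_lfunE subr_eq0.
exact: eqP.
Qed.

(** The rows of [B] are the coordinates of a basis of the eigenspace; they lie
    in the eigenspace of the matrix of [g], whose rank is thus large enough. *)
Lemma dvdp_lchar_poly_leigenspace a :
  ('X - a%:P) ^+ \dim (leigenspace g a) %| lchar_poly g.
Proof.
set b := vbasis {:vT}; have b_basis : basis_of {:vT} b := vbasisP _.
set U := leigenspace g a; set u := vbasis U.
set B := \matrix_(i < \dim U) rVof b u`_i.
have B_free : row_free B.
  apply: row_free_free_tuple; first exact: can_inj (rVofK b_basis).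
  exact: basis_free (vbasisP U).
have B_eigen : (B <= eigenspace (mxof b b g) a)%MS.
  apply/eigenspaceP/row_matrixP => i; rewrite row_mul linearZ /= !rowK.
  have /leigenspaceP u_eigen : u`_i \in U.
    by rewrite vbasis_mem // mem_nth ?size_tuple.
  by rewrite -rVof_app // u_eigen linearZ.
apply: dvdp_trans (dvdp_char_poly_eigenspace _ a); apply: dvdp_exp2l.
by rewrite -(eqP B_free) mxrankS.
Qed.

(** Once enough eigenvectors are known, nothing else can occur: the powers
    [('X - r i) ^+ d i] are pairwise coprime divisors of the characteristic
    polynomial, and their product already has its degree. *)
Lemma lchar_poly_eigenvalues (I : finType) (r : I -> K) (d : I -> nat) :
    injective r -> (forall i, d i <= \dim (leigenspace g (r i)))%N ->
    (\sum_i d i = \dim {:vT})%N ->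
  lchar_poly g = \prod_i ('X - (r i)%:P) ^+ d i.
Proof.
move=> r_inj d_le d_sum; set q := \prod_i _.
have q_monic : q \is monic.
  by apply: monic_prod => i _; rewrite monic_exp ?monicXsubC.
have q_size : size q = (\dim {:vT}).+1.
  rewrite size_prod => [|i _]; last by rewrite expf_neq0 ?polyXsubC_eq0.
  under eq_bigr do rewrite size_exp_XsubC -addn1.
  by rewrite big_split /= sum1_card d_sum -addSn addnK.
have q_dvd : q %| lchar_poly g.
  rewrite /q; elim: (index_enum I) (index_enum_uniq I) => [|i s IHs] /=.
    by rewrite big_nil dvd1p.
  move=> /andP[i_s s_uniq]; rewrite big_cons Gauss_dvdp; last first.
    apply: coprimep_expl; rewrite coprimep_sym coprimep_XsubC /root horner_prod.
    rewrite prodf_seq_neq0; apply/allP => j j_s /=.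
    rewrite horner_exp expf_neq0 // !hornerE subr_eq0 (inj_eq r_inj).
    by apply: contraNneq i_s => ->.
  rewrite IHs // andbT.
  by apply: dvdp_trans (dvdp_lchar_poly_leigenspace _); apply: dvdp_exp2l.
apply/eqP; rewrite eq_sym -eqp_monic ?lchar_poly_monic //.
by rewrite -dvdp_size_eqp // q_size size_lchar_poly.
Qed.

End LinearCharPoly.

(** * The secular function *)

(** The logarithmic derivative of [p = \prod_i ('X - F i)]. It makes the
    secular function equal to [- p' / p] for [F] the resistance deviations. *)
Lemma horner_deriv_prod_XsubC (K : fieldType) (I : Type) (s : seq I)
    (F : I -> K) (x : K) :
    (forall i, F i != x) ->
  (\prod_(i <- s) ('X - (F i)%:P))^`().[x] =
  - (\prod_(i <- s) ('X - (F i)%:P)).[x] * \sum_(i <- s) (F i - x)^-1.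
Proof.
move=> Fx; elim: s => [|i s IHs]; first by rewrite !big_nil -polyC1 derivC horner0 mulr0.
rewrite !big_cons derivM derivXsubC !hornerE IHs mulrDr !mulNr.
have Fxi : F i - x != 0 by rewrite subr_eq0.
by rewrite -[x - F i]opprB !mulNr !opprK mulrAC mulfV // mul1r !mulrN opprK mulrA.
Qed.

Section Secular.
Variables (R : realType) (n : nat) (Ld : 'M[R]_n).
Local Notation dev := (dev Ld).
Local Notation alpha := (devs Ld).

Lemma devs_sorted : sorted <%R alpha.
Proof. by rewrite sort_lt_sorted undup_uniq. Qed.

Lemma devs_uniq : uniq alpha.
Proof. by rewrite sort_uniq undup_uniq. Qed.

Lemma mem_devsP a : reflect (exists j, a = dev j) (a \in alpha).
Proof.
rewrite mem_sort mem_undup.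
by apply: (iffP mapP) => [[j _ ->]|[j ->]]; exists j; rewrite ?mem_enum.
Qed.

Lemma dev_mem_devs j : dev j \in alpha. Proof. by apply/mem_devsP; exists j. Qed.

Lemma ltr_devs i j : (i < size alpha)%N -> (j < size alpha)%N ->
  (alpha`_i < alpha`_j) = (i < j)%N.
Proof. by move=> ik jk; rewrite (lt_sorted_ltn_nth 0 devs_sorted). Qed.

Lemma dev_class_gt0 i : (i < size alpha)%N -> (0 < #|dev_class Ld i|)%N.
Proof.
move=> ik; have /mem_devsP[j aj] := mem_nth 0 ik.
by apply/card_gt0P; exists j; rewrite inE aj.
Qed.

Lemma size_devs_gt0 : (0 < n)%N -> (0 < size alpha)%N.
Proof. by move=> n0; move: (dev_mem_devs (Ordinal n0)); case: devs. Qed.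

(** Grouping a sum over the vertices by the value of the deviation; it gives
    both forms of the secular function, and [n] as the sum of the
    multiplicities. *)
Lemma sum_dev (V : nmodType) (F : R -> V) :
  \sum_j F (dev j) = \sum_(i < size alpha) F alpha`_i *+ #|dev_class Ld i|.
Proof.
under [RHS]eq_bigr => i _ do rewrite -sumr_const.
rewrite (exchange_big_dep xpredT) //=; apply: eq_bigr => j _.
have jk : (index (dev j) alpha < size alpha)%N by rewrite index_mem dev_mem_devs.
rewrite (big_pred1 (Ordinal jk)) /= ?nth_index ?dev_mem_devs // => i /=.
rewrite inE -val_eqE /=.
by apply/eqP/eqP => ->; rewrite ?index_uniq ?devs_uniq ?nth_index ?dev_mem_devs.
Qed.

Lemma secular_devs x :
  secular Ld x = \sum_(i < size alpha) #|dev_class Ld i|%:R / (alpha`_i - x).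
Proof.
rewrite /secular (sum_dev (fun a => (a - x)^-1)).
by apply: eq_bigr => i _; rewrite mulr_natl.
Qed.

Lemma sum_card_dev_class : (\sum_(i < size alpha) #|dev_class Ld i| = n)%N.
Proof.
rewrite -[RHS]card_ord -sum1_card (sum_dev (fun=> 1%N)).
by apply: eq_bigr => i _; rewrite -mulr_natl mulr1 natn.
Qed.

(** No deviation lies between [alpha`_i] and [alpha`_i.+1]. The two bounds [x]
    and [y] are separate so that the lemma serves for a point ([x = y]) and for
    a segment. *)
Lemma dev_gap i j x y :
    (i.+1 < size alpha)%N -> alpha`_i < x -> y < alpha`_i.+1 ->
  (dev j < x) || (y < dev j).
Proof.
move=> ik ax ya; have /(nthP 0)[l lk <-] := dev_mem_devs j.
case: (ltnP i l) => il; apply/orP; [right|left].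
  by apply: lt_le_trans ya _; rewrite leNgt ltr_devs // -leqNgt.
by apply: le_lt_trans ax; rewrite leNgt ltr_devs ?(ltnW ik) // -leqNgt.
Qed.

(** Each term [(dev j - x)^-1] increases with [x] as long as [x] does not cross
    the pole [dev j]. *)
Lemma ltr_secular x y :
    (0 < n)%N -> x < y -> (forall j, (dev j < x) || (y < dev j)) ->
  secular Ld x < secular Ld y.
Proof.
move=> n0 xy gap; apply: ltr_sum => [|j _].
  by apply/hasP; exists (Ordinal n0); rewrite ?mem_index_enum.
have xyj : dev j - y < dev j - x by rewrite ltrD2l ltrN2.
case/orP: (gap j) => jxy; last first.
  have y0 : 0 < dev j - y by rewrite subr_gt0.
  by rewrite ltf_pV2 ?posrE // (lt_trans y0).
have x0 : dev j - x < 0 by rewrite subr_lt0.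
by rewrite ltf_nV2 ?negrE // (lt_trans xyj).
Qed.

(** Rolle's theorem for [p = \prod_j ('X - dev j)], which vanishes at both ends
    of the gap: [p'] has a root inside, where [p] does not vanish, and the
    secular function is [- p' / p] there. *)
Lemma secular_root_gap i : (i.+1 < size alpha)%N ->
  exists2 x, alpha`_i < x < alpha`_i.+1 & secular_root Ld x.
Proof.
move=> ik; pose p := \prod_j ('X - (dev j)%:P).
have p_root l : (l < size alpha)%N -> p.[alpha`_l] = 0.
  move=> lk; have /mem_devsP[j ->] := mem_nth 0 lk.
  by rewrite horner_prod (bigD1 j) //= !hornerE subrr mul0r.
have aa : alpha`_i < alpha`_i.+1 by rewrite ltr_devs ?(ltnW ik).
have [|x xi p'x] := poly_rolle aa (p := p).
  by rewrite !p_root ?(ltnW ik).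
move: xi; rewrite in_itv /= => /andP[ax xa]; exists x; first by rewrite ax xa.
have devx j : dev j != x.
  by have := dev_gap j ik ax xa; rewrite -neq_lt.
split=> //; move: p'x; rewrite horner_deriv_prod_XsubC // => /eqP.
rewrite mulf_eq0 oppr_eq0 horner_prod => /orP[|/eqP//].
rewrite prodf_seq_eq0 => /hasP[j _ /=]; rewrite !hornerE subr_eq0.
by rewrite eq_sym (negPf (devx j)).
Qed.

Lemma secular_root_gap_unique i x y : (0 < n)%N -> (i.+1 < size alpha)%N ->
    alpha`_i < x < alpha`_i.+1 -> secular_root Ld x ->
    alpha`_i < y < alpha`_i.+1 -> secular_root Ld y ->
  x = y.
Proof.
move=> n0 ik; wlog xy : x y / x <= y => [IH|].
  by case: (leP x y) => [/IH//|/ltW/IH yx *]; symmetry; exact: yx.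
move=> /andP[ax _] [_ fx] /andP[_ ya] [_ fy]; apply: contraTeq isT => xDy.
have xy' : x < y by rewrite lt_neqAle xDy.
have := ltr_secular n0 xy' (fun j => dev_gap j ik ax ya).
by rewrite fx fy ltxx.
Qed.

(** To the left of all deviations every term of the secular function is
    positive, to the right of them every term is negative; so a root has
    deviations on both sides. *)
Lemma secular_root_in_gap x : (0 < n)%N -> secular_root Ld x ->
  exists2 i, (i.+1 < size alpha)%N & alpha`_i < x < alpha`_i.+1.
Proof.
move=> n0 [devx fx].
have sep j : (dev j < x) || (x < dev j) by rewrite -neq_lt.
have [j jx] : exists j, dev j < x.
  apply/existsP; apply: contraT; rewrite negb_exists => /forallP dev_ge.
  have t_ge0 j : true -> 0 <= (dev j - x)^-1 by rewrite invr_ge0 subr_ge0 leNgt.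
  have /(_ (Ordinal n0) isT)/eqP := psumr_eq0P t_ge0 fx.
  by rewrite invr_eq0 subr_eq0 (negPf (devx _)).
have [l xl] : exists j, x < dev j.
  apply/existsP; apply: contraT; rewrite negb_exists => /forallP dev_le.
  have t_ge0 i : true -> 0 <= - (dev i - x)^-1.
    by rewrite oppr_ge0 invr_le0 subr_le0 leNgt.
  have /(psumr_eq0P t_ge0)/(_ (Ordinal n0) isT)/eqP :
      \sum_i - (dev i - x)^-1 = 0 by rewrite sumrN -/(secular Ld x) fx oppr0.
  by rewrite oppr_eq0 invr_eq0 subr_eq0 (negPf (devx _)).
(* The right end of the gap is the first deviation above [x]. *)
have x_has : has (> x) alpha by apply/hasP; exists (dev l); rewrite ?dev_mem_devs.
have x_nth := nth_find 0 x_has; have x_before := @before_find _ 0 (> x) alpha.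
move: x_has x_nth x_before; rewrite has_find.
case: find => [|i] /= ik xi before.
  have /(nthP 0)[m mk mj] := dev_mem_devs j.
  by have := lt_trans jx xi; rewrite -mj ltr_devs.
exists i => //; rewrite xi andbT lt_neqAle leNgt before // andbT.
by have /mem_devsP[h ->] := mem_nth 0 (ltnW ik).
Qed.

End Secular.

(** * The resistance deviation operator *)

Section Operator.
Variables (R : realType) (n : nat) (n_gt0 : (0 < n)%N) (Ld : 'M[R]_n).
Local Notation dev := (dev Ld).
Local Notation alpha := (devs Ld).
Local Notation T := (rdop Ld).
Local Notation Tperp := (rdop_perp Ld).
Implicit Types x : 'cV[R]_n.

Let nN0 : n%:R != 0 :> R. Proof. by rewrite pnatr_eq0 -lt0n. Qed.

Lemma sum_onesP x : ones^T *m x = 0 <-> \sum_j x j 0 = 0.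
Proof.
have E : (ones^T *m x) 0 0 = \sum_j x j 0.
  by rewrite mxE; apply: eq_bigr => j _; rewrite !mxE mul1r.
rewrite -E; split=> [->|E0]; first by rewrite mxE.
by apply/matrixP => i j; rewrite !ord1 E0 mxE.
Qed.

Lemma devmxE : devmx Ld = diag_mx (\row_j dev j).
Proof.
apply/matrixP => i j; rewrite /Defs.dev !mxE.
by case: eqP => [->|_]; rewrite ?eqxx ?mulr1n ?mulr0n ?subr0.
Qed.

Lemma sum_dev0 : \sum_j dev j = 0.
Proof.
under eq_bigr do rewrite /Defs.dev !mxE eqxx !mulr1n.
rewrite sumrB sumr_const card_ord /dbar -[X in _ - X]mulr_natl mulrA mulfV // mul1r.
by rewrite subrr.
Qed.

Lemma allonesE : (allones : 'M[R]_n) = const_mx 1.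
Proof. by apply/matrixP => i j; rewrite !mxE big_ord1 !mxE mulr1. Qed.

(** Characteristic polynomials come with the action on row vectors, while the
    operator acts on columns; symmetry identifies the two. *)
Lemma trmx_rdop : T^T = T.
Proof.
rewrite /rdop linearB linearD /= !trmx_mul devmxE tr_diag_mx.
rewrite /ctrmx linearB linearZ /= trmx1 allonesE trmx_const.
by rewrite [X in X - _]addrC.
Qed.

Lemma rdopE x i :
  (T *m x) i 0 = dev i * x i 0 - n%:R^-1 * \sum_j dev j * x j 0
                 - n%:R^-1 * dev i * \sum_j x j 0.
Proof.
have cE (y : 'cV[R]_n) k : (ctrmx *m y) k 0 = y k 0 - n%:R^-1 * \sum_j y j 0 :> R.
  rewrite /ctrmx allonesE mulmxBl mul1mx -scalemxAl !mxE; congr (_ - _ * _).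
  by apply: eq_bigr => j _; rewrite !mxE mul1r.
have dE (y : 'cV[R]_n) k : (devmx Ld *m y) k 0 = dev k * y k 0.
  by rewrite devmxE mul_diag_mx !mxE.
have DB (y z w : 'cV[R]_n) : (y + z - w) i 0 = y i 0 + z i 0 - w i 0.
  by rewrite !mxE.
rewrite /rdop mulmxBl mulmxDl -!mulmxA DB !(dE, cE).
rewrite [\sum_j (devmx Ld *m x) j 0](eq_bigr _ (fun j _ => dE x j)).
by ring.
Qed.

Lemma rdop_ones : T *m ones = 0.
Proof.
apply/colP => i; rewrite rdopE.
have -> : \sum_j dev j * (ones : 'cV[R]_n) j 0 = 0.
  by rewrite -[RHS]sum_dev0; apply: eq_bigr => j _; rewrite !mxE mulr1.
have -> : \sum_j (ones : 'cV[R]_n) j 0 = n%:R.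
  by under eq_bigr do rewrite mxE; rewrite sumr_const card_ord.
by rewrite !mxE; field.
Qed.

(** On the orthogonal complement of [ones] the operator maps [x] to
    [dev * x - c], where [c] is the mean of [dev * x]; so being an eigenvector
    only says that [(dev j - a) * x j] is independent of [j]. Conversely, if it
    is a constant, then the constant is this mean, because [x] sums to 0. *)
Lemma rdop_eigenP a x : ones^T *m x = 0 ->
  T *m x = a *: x <-> exists c, forall j, (dev j - a) * x j 0 = c.
Proof.
move=> /sum_onesP x0; split=> [Tx|[c xc]].
  exists (n%:R^-1 * \sum_j dev j * x j 0) => j.
  have := congr1 (fun y : 'cV_n => y j 0) Tx; rewrite rdopE x0 mulr0 subr0 mxE.
  by rewrite mulrBl => <-; rewrite opprB addrC subrK.
apply/colP => i; rewrite rdopE x0 mulr0 subr0 mxE.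
have -> : \sum_j dev j * x j 0 = n%:R * c.
  transitivity (\sum_j ((dev j - a) * x j 0 + a * x j 0)).
    by apply: eq_bigr => j _; rewrite mulrBl subrK.
  rewrite big_split /= -mulr_sumr x0 mulr0 addr0.
  by under eq_bigr do rewrite xc; rewrite sumr_const card_ord mulr_natl.
by rewrite mulKf // -(xc i) mulrBl opprB addrC subrK.
Qed.

(** For [a = alpha`_i] the constant of [rdop_eigenP] is 0, as a vertex [h] with
    [dev h = a] shows; hence [x] vanishes wherever [dev j] differs from [a]. *)
Lemma dev_space_eigenP i x : (i < size alpha)%N ->
  dev_space Ld i x <-> ones^T *m x = 0 /\ T *m x = alpha`_i *: x.
Proof.
move=> ik; have /mem_devsP[h ah] := mem_nth 0 ik.
split=> [[/subsetP x_supp x1]|[x1 /(rdop_eigenP _ x1)[c xc]]]; split => //.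
  apply/rdop_eigenP => //; exists 0 => j.
  have [->|xj0] := eqVneq (x j 0) 0; first by rewrite mulr0.
  by have := x_supp j; rewrite !inE => /(_ xj0)/eqP->; rewrite subrr mul0r.
apply/subsetP => j; rewrite !inE => xj0.
have : (dev j - alpha`_i) * x j 0 = 0 by rewrite xc -(xc h) -ah subrr mul0r.
by move/eqP; rewrite mulf_eq0 (negPf xj0) orbF subr_eq0.
Qed.

(** The vectors supported in [A] are the image of ['cV_#|A|] under the injection
    [f] that fills in zeros outside [A], and the sum of the entries is a nonzero
    linear form [s] on this image; its kernel has codimension 1. *)
Lemma dim_supported_onesperp (A : {set 'I_n}) : (0 < #|A|)%N ->
  has_dim (fun x => supp x \subset A /\ ones^T *m x = 0) (#|A| - 1)%N.
Proof.
move=> A_gt0; pose E : 'M[R]_(n, #|A|) := \matrix_(i, k) (i == enum_val k)%:R.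
pose f : 'Hom('cV[R]_#|A|, 'cV[R]_n) := linfun (mulmx E).
pose s : 'Hom('cV[R]_n, 'cV[R]_1) := linfun (mulmx (ones^T : 'rV[R]_n)).
have fE y k : f y (enum_val k) 0 = y k 0.
  rewrite lfunE /= mxE (bigD1 k) //= mxE eqxx mul1r big1 ?addr0 // => l lk.
  by rewrite mxE (inj_eq enum_val_inj) eq_sym (negPf lk) mul0r.
have fN y i : i \notin A -> f y i 0 = 0.
  move=> iA; rewrite lfunE /= mxE big1 // => l _; rewrite mxE.
  by case: eqP iA => [->|_]; rewrite ?enum_valP ?mul0r.
have memf x : (x \in limg f) = (supp x \subset A).
  apply/memv_imgP/subsetP => [[y _ ->] i|x_supp].
    by rewrite inE; apply: contraNT => /fN->.
  exists (\col_k x (enum_val k) 0); first exact: memvf.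
  apply/colP => i; have [iA|iA] := boolP (i \in A).
    by rewrite -(enum_rankK_in iA iA) fE mxE.
  rewrite fN //; apply/eqP; apply: contraNT iA => xi.
  by apply: x_supp; rewrite inE.
exists (limg f :&: lker s)%VS; split=> [x|].
  rewrite memv_cap memf memv_ker lfunE /=.
  by split=> [/andP[? /eqP]|[-> ->]]; rewrite ?eqxx.
have dim_f : \dim (limg f) = #|A|.
  rewrite limg_dim_eq ?dimvf ?dim_matrix; first exact: muln1.
  apply/eqP; rewrite -subv0; apply/subvP => y; rewrite memv_cap memv_ker memv0.
  by case/andP=> _ /eqP fy; apply/eqP/colP => k; rewrite -fE fy !mxE.
have dim_s : \dim (s @: limg f) = 1%N.
  apply/eqP; rewrite eqn_leq; apply/andP; split.
    by apply: leq_trans (dimvS (subvf _)) _; rewrite dimvf dim_matrix.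
  have /card_gt0P[j jA] := A_gt0.
  rewrite lt0n dimv_eq0; apply/negP => /eqP s0.
  have : s (delta_mx j 0) \in (s @: limg f)%VS.
    apply: memv_img; rewrite memf; apply/subsetP => i; rewrite inE mxE andbT.
    by case: (i =P j) => [-> //|_]; rewrite eqxx.
  rewrite s0 memv0 lfunE /= -colE => /eqP/matrixP/(_ 0 0)/eqP.
  by rewrite !mxE oner_eq0.
apply: (canRL (addnK 1)).
by have := limg_ker_dim s (limg f); rewrite dim_f dim_s.
Qed.

Lemma dim_dev_space i : (i < size alpha)%N ->
  has_dim (dev_space Ld i) (#|dev_class Ld i| - 1)%N.
Proof. by move=> ik; apply/dim_supported_onesperp/dev_class_gt0. Qed.

Lemma dim_onesperp : \dim {:subvs_of (onesperp R n)} = n.-1.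
Proof.
rewrite dimvf /dim /=.
have [U [memU dimU]] : has_dim
    (fun x => supp x \subset [set: 'I_n] /\ ones^T *m x = 0)
    (#|[set: 'I_n]| - 1)%N.
  by apply: dim_supported_onesperp; rewrite cardsT card_ord.
rewrite cardsT card_ord subn1 in dimU; rewrite -dimU; congr (\dim _).
apply/vspaceP => x; rewrite memv_onesperp; apply/eqP/idP => [x1|/memU[]//].
by apply/memU; rewrite subsetT.
Qed.

Lemma leigenspace_rdop_perpP a (u : subvs_of (onesperp R n)) :
  reflect (T *m vsval u = a *: vsval u) (u \in leigenspace Tperp a).
Proof.
apply: (iffP (leigenspaceP _ _ _)) => [gu|Tu].
  by rewrite -val_rdop_perp // gu linearZ.
by apply: val_inj; rewrite [LHS]val_rdop_perp // Tu [RHS]linearZ.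
Qed.

(** Transports dimensions from subspaces of ['cV_n], where the eigenspaces are
    described, to the carrier of the restricted operator. *)
Lemma dim_leigenspace_rdop_perp a d :
    has_dim (fun x => ones^T *m x = 0 /\ T *m x = a *: x) d ->
  \dim (leigenspace Tperp a) = d.
Proof.
move=> [U [memU <-]].
pose f : 'Hom(subvs_of (onesperp R n), 'cV[R]_n) := linfun vsval.
rewrite -(@limg_dim_eq _ _ _ f); last first.
  apply/eqP; rewrite -subv0; apply/subvP => u; rewrite memv_cap memv_ker memv0.
  by case/andP=> _; rewrite lfunE /= => /eqP u0; apply/eqP/val_inj.
congr (\dim _); apply/vspaceP => x; apply/memv_imgP/idP => [[u]|/memU[x1 Tx]].
  move=> /leigenspace_rdop_perpP Tu ->; rewrite lfunE; apply/memU; split=> //.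
  by apply/eqP; rewrite -memv_onesperp subvsP.
have x_perp : x \in onesperp R n by rewrite memv_onesperp x1.
exists (vsproj _ x); last by rewrite lfunE /= vsprojK.
by apply/leigenspace_rdop_perpP; rewrite vsprojK.
Qed.

(** Off the deviations, [rdop_eigenP] forces [x j = c / (dev j - a)] with a
    nonzero [c], and such a vector sums to 0 exactly when the secular function
    vanishes at [a]. *)
Lemma leigenvalue_rdop_perpP a : a \notin alpha ->
  leigenvalue Tperp a <-> secular_root Ld a.
Proof.
move=> a_alpha; have dev_a j : dev j - a != 0.
  by rewrite subr_eq0; apply: contraNneq a_alpha => <-; apply: dev_mem_devs.
split=> [a_eigen|[_ fa]].
  split=> [j|]; first by rewrite -subr_eq0.
  have u_in := memv_pick (leigenspace Tperp a).
  have u0 : vpick (leigenspace Tperp a) != 0 by rewrite vpick0.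
  move: (vpick _) u_in u0 => u /leigenspace_rdop_perpP Tu u0.
  have u1 : ones^T *m vsval u = 0 by apply/eqP; rewrite -memv_onesperp subvsP.
  have [c uc] := (rdop_eigenP a u1).1 Tu.
  have uE j : vsval u j 0 = c * (dev j - a)^-1.
    by rewrite -(uc j) mulrAC mulfV ?mul1r.
  have c0 : c != 0.
    apply: contraNneq u0 => c0; apply/eqP/val_inj/colP => j.
    by rewrite /= uE c0 mul0r mxE.
  have /sum_onesP := u1; under eq_bigr do rewrite uE.
  rewrite -mulr_sumr => /eqP.
  by rewrite mulf_eq0 (negPf c0) => /eqP.
pose x : 'cV[R]_n := \col_j (dev j - a)^-1.
have x1 : ones^T *m x = 0.
  by apply/sum_onesP; rewrite -[RHS]fa; apply: eq_bigr => j _; rewrite mxE.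
have Tx : T *m x = a *: x.
  by apply/rdop_eigenP => //; exists 1 => j; rewrite mxE mulfV.
have x_perp : x \in onesperp R n by rewrite memv_onesperp x1.
have : vsproj (onesperp R n) x \in leigenspace Tperp a.
  by apply/leigenspace_rdop_perpP; rewrite vsprojK.
apply: contraTneq => ->; rewrite memv0; apply/negP => /eqP x0.
have := congr1 vsval x0; rewrite vsprojK // => /colP/(_ (Ordinal n_gt0))/eqP.
by rewrite !mxE invr_eq0 (negPf (dev_a _)).
Qed.

(** In a basis formed by [ones] and a basis of its orthogonal complement, the
    operator is block diagonal with blocks [0] and the matrix of the
    restriction. *)
Lemma char_poly_rdop : char_poly T = 'X * lchar_poly Tperp.
Proof.
set b := vbasis {:subvs_of (onesperp R n)}.
have b_basis : basis_of {:subvs_of (onesperp R n)} b := vbasisP _.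
pose f := trmx \o (vsval : subvs_of (onesperp R n) -> 'cV[R]_n).
have f1 u : f u *m ones = 0.
  rewrite -[LHS]trmxK trmx_mul trmxK; apply/eqP; rewrite trmx_eq0.
  by rewrite -memv_onesperp subvsP.
pose B := \matrix_(i < \dim {:subvs_of (onesperp R n)}) f b`_i.
have B_free : row_free B.
  apply: row_free_free_tuple (basis_free b_basis).
  exact: inj_comp (can_inj (@trmxK _ _ _)) val_inj.
have B1 : B *m ones = 0 by apply/row_matrixP => i; rewrite row_mul rowK f1 row0.
have BT : B *m T = mxof b b Tperp *m B.
  apply/row_matrixP => i; rewrite !row_mul rowK.
  have -> : row i (mxof b b Tperp) = rVof b (Tperp b`_i).
    by rewrite rowE mul_mxof vecof_delta.
  transitivity (f (Tperp b`_i)).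
    by rewrite /f /= val_rdop_perp // trmx_mul trmx_rdop.
  rewrite -[in LHS](rVofK b_basis (Tperp _)) mulmx_sum_row /vecof /f /= !linear_sum.
  by apply: eq_bigr => j _; rewrite !linearZ /= rowK.
pose S := col_mx (ones^T : 'rV[R]_n) B.
have -> : char_poly T = char_poly (block_mx (0 : 'M_1) 0 0 (mxof b b Tperp)).
  apply: (@char_poly_intertwine _ _ _ S).
  - by rewrite dim_onesperp add1n prednK.
  - rewrite -kermx_eq0; apply/eqP/row_matrixP => i; rewrite row0.
    have : row i (kermx S) *m S = 0 by rewrite -row_mul mulmx_ker row0.
    move: (row i _) => c; rewrite -[c]hsubmxK mul_row_col => cS.
    (* Pairing with [ones] kills the rows of [B] and isolates the first
       coefficient. *)
    have c1 : lsubmx c = 0.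
      have := congr1 (mulmx^~ ones) cS.
      rewrite mulmxDl -!mulmxA B1 mulmx0 addr0 mul0mx => /matrixP cS1.
      apply/matrixP => k l; rewrite !ord1; have := cS1 0 0.
      rewrite !mxE big_ord1 !mxE; under eq_bigr do rewrite !mxE mulr1.
      rewrite sumr_const card_ord => /eqP; rewrite mulf_eq0 (negPf nN0) orbF.
      by move/eqP.
    move: cS; rewrite c1 mul0mx add0r => cB.
    have -> : rsubmx c = 0 by apply: (row_free_inj B_free); rewrite /= mul0mx.
    exact: row_mx0.
  rewrite mul_col_mx mul_block_col !mul0mx !add0r BT.
  congr col_mx; rewrite -[LHS]trmxK trmx_mul trmx_rdop trmxK rdop_ones.
  by rewrite trmx0.
rewrite /char_poly char_block_diag_mx det_ublock; congr (_ * _).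
by rewrite det_mx11 !mxE subr0.
Qed.

Lemma secular_root_notin (x : R) : secular_root Ld x -> x \notin alpha.
Proof.
by case=> devx _; apply/mem_devsP => -[j /eqP]; rewrite eq_sym (negPf (devx j)).
Qed.

(** There is one root in each of the gaps between consecutive deviations, and
    each root is in a gap. *)
Lemma secular_roots_enum : exists lam : seq R,
  [/\ uniq lam, size lam = (size alpha - 1)%N
    & forall x : R, x \in lam <-> secular_root Ld x].
Proof.
have ltSk (i : 'I_(size alpha - 1)) : (i.+1 < size alpha)%N.
  by have := ltn_ord i; rewrite ltn_subRL add1n.
have /fin_all_exists[r rP] : forall i : 'I_(size alpha - 1), exists x : R,
    alpha`_i < x < alpha`_i.+1 /\ secular_root Ld x.
  by move=> i; have [x] := secular_root_gap (ltSk i); exists x.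
have r_homo (i j : 'I_(size alpha - 1)) : (i < j)%N -> r i < r j.
  move=> ij; have [/andP[_ ri] _] := rP i; have [/andP[rj _] _] := rP j.
  apply: lt_trans ri (le_lt_trans _ rj).
  by rewrite leNgt ltr_devs ?(ltnW (ltSk j)) // -leqNgt.
have r_inj : injective r.
  move=> i j rij; apply: val_inj; case: (ltngtP i j) => // /r_homo;
  by rewrite rij ltxx.
exists (codom r); split=> [||x].
- by rewrite map_inj_uniq ?enum_uniq.
- by rewrite size_codom card_ord.
split=> [/codomP[i ->]|xP]; first exact: (rP i).2.
have [i ik xi] := secular_root_in_gap n_gt0 xP.
have ik1 : (i < size alpha - 1)%N by rewrite ltn_subRL add1n.
have [ri rootr] := rP (Ordinal ik1).
by rewrite (secular_root_gap_unique n_gt0 ik xi xP ri rootr) codom_f.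
Qed.

(** The eigenspaces found so far have dimensions [m_i - 1] for the deviations
    and at least 1 for the secular roots. If [k] is the number of distinct
    deviations, this makes [(n - k) + (k - 1) = n - 1], the full dimension. *)
Lemma lchar_poly_rdop_perp (lam : seq R) :
    uniq lam -> size lam = (size alpha - 1)%N ->
    (forall x : R, x \in lam -> secular_root Ld x) ->
  lchar_poly Tperp =
    (\prod_(i < size alpha) ('X - (alpha`_i)%:P) ^+ (#|dev_class Ld i| - 1)) *
    \prod_(l <- lam) ('X - l%:P).
Proof.
move=> lam_uniq lam_size lamP.
pose r (i : 'I_(size alpha) + 'I_(size lam)) :=
  match i with inl i => alpha`_i | inr i => lam`_i end.
pose d (i : 'I_(size alpha) + 'I_(size lam)) :=
  match i with inl i => (#|dev_class Ld i| - 1)%N | inr _ => 1%N end.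
have lam_root (i : 'I_(size lam)) : secular_root Ld lam`_i.
  by apply: lamP; rewrite mem_nth.
have lam_alpha (i : 'I_(size alpha)) (j : 'I_(size lam)) : alpha`_i <> lam`_j.
  by move=> ij; have := secular_root_notin (lam_root j); rewrite -ij mem_nth.
rewrite (@lchar_poly_eigenvalues _ _ _ _ r d).
- rewrite big_sumType /= (big_nth 0) big_mkord.
  by congr (_ * _); apply: eq_bigr => i _; rewrite expr1.
- move=> [i|i] [j|j] /= ij; last 1 first.
  + congr inr; apply/val_inj/eqP.
    by rewrite -(nth_uniq 0 (ltn_ord i) (ltn_ord j) lam_uniq) ij.
  + congr inl; apply/val_inj/eqP.
    by rewrite -(nth_uniq 0 (ltn_ord i) (ltn_ord j) (devs_uniq Ld)) ij.
  + by case: (lam_alpha i j).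
  + by case: (lam_alpha j i).
- move=> [i|i] /=.
    rewrite -(@dim_leigenspace_rdop_perp alpha`_i (#|dev_class Ld i| - 1)) //.
    have [U [memU dimU]] := dim_dev_space (ltn_ord i); exists U; split=> // x.
    by rewrite memU dev_space_eigenP.
  have lam_i := lam_root i.
  have := (leigenvalue_rdop_perpP (secular_root_notin lam_i)).2 lam_i.
  by rewrite lt0n dimv_eq0.
rewrite big_sumType /= sum1_card card_ord lam_size dim_onesperp.
have k_gt0 := size_devs_gt0 Ld n_gt0.
rewrite -[in RHS](sum_card_dev_class Ld).
have -> : (\sum_(i < size alpha) #|dev_class Ld i| =
    \sum_(i < size alpha) (#|dev_class Ld i| - 1) + size alpha)%N.
  rewrite -[X in (_ = _ + X)%N]card_ord -sum1_card -big_split /=.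
  by apply: eq_bigr => i _; rewrite subnK // dev_class_gt0.
by rewrite -subn1 addnBA.
Qed.

(** The factorization gives algebraic multiplicity one, which bounds the
    dimension of the eigenspace. *)
Lemma simple_eigenvalue_secular_root (x : R) :
  secular_root Ld x -> simple_eigenvalue Tperp x.
Proof.
move=> xP; have x_alpha := secular_root_notin xP.
have [lam [lam_uniq lam_size lamP]] := secular_roots_enum.
have x_mup : mup x (lchar_poly Tperp) = 1%N.
  rewrite (lchar_poly_rdop_perp lam_uniq lam_size) => [|y /lamP//].
  rewrite mupMr ?mu_prod_XsubC ?count_uniq_mem //; first by rewrite (lamP x).2.
  rewrite /root horner_prod; apply/prodf_neq0 => i _.
  rewrite horner_exp expf_neq0 // !hornerE subr_eq0.
  by apply: contraNneq x_alpha => ->; rewrite mem_nth.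
have le1E d : (d <= 1)%N = (('X - x%:P) ^+ d %| lchar_poly Tperp).
  by rewrite -mup_geq ?x_mup // monic_neq0 ?lchar_poly_monic.
split=> //; apply/eqP; rewrite eqn_leq le1E dvdp_lchar_poly_leigenspace.
rewrite lt0n dimv_eq0.
exact: (leigenvalue_rdop_perpP x_alpha).2.
Qed.

Lemma rdop_eigenvalueP a :
  (exists2 x : 'cV[R]_n, x != 0 & T *m x = a *: x) <-> root (char_poly T) a.
Proof.
rewrite -eigenvalue_root_char; split=> [[x x0 Tx]|/eigenvalueP[v Tv v0]].
  apply/eigenvalueP; exists x^T; last by rewrite trmx_eq0.
  by rewrite -trmx_rdop -trmx_mul Tx linearZ.
exists v^T; first by rewrite trmx_eq0.
by rewrite -trmx_rdop -trmx_mul Tv linearZ.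
Qed.

End Operator.

(** * The spectrum *)

Theorem theorem2p5 (R : realType) (n : nat) (n_gt0 : (0 < n)%N)
    (e : rel 'I_n) (e_sym : symmetric e) (e_irr : irreflexive e)
    (e_conn : forall i j : 'I_n, connect e i j)
    (Ld : 'M[R]_n) (LdP : is_lap_pinv e Ld) :
  let T := rdop Ld in
  let Tperp := rdop_perp Ld in
  let alpha := devs Ld in
  let k := size alpha in
  let m := fun i : nat => #|dev_class Ld i| in
  [/\ T *m ones = 0,
      forall i : nat, (i < k)%N ->
        (forall x : 'cV[R]_n,
           dev_space Ld i x <->
           (ones^T *m x = 0 /\ T *m x = alpha`_i *: x)) /\
        has_dim (dev_space Ld i) (m i - 1)%N,
      forall lambda : R, (forall j, dev Ld j != lambda) ->
        secular Ld lambda = \sum_(i < k) (m i)%:R / (alpha`_i - lambda)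
    & exists lam : seq R,
        [/\ uniq lam /\ size lam = (k - 1)%N,
            (forall lambda : R,
               lambda \in lam <->
               (leigenvalue Tperp lambda /\ lambda \notin alpha)) /\
            (forall lambda : R,
               lambda \in lam <-> secular_root Ld lambda),
            forall lambda : R, lambda \in lam ->
               simple_eigenvalue Tperp lambda,
            forall i : nat, (i.+1 < k)%N ->
               exists! lambda : R,
                 alpha`_i < lambda < alpha`_i.+1 /\ secular_root Ld lambda
          & [/\ forall lambda : R,
                  (exists2 x : 'cV[R]_n, x != 0 & T *m x = lambda *: x) <->
                  [\/ lambda = 0,
                      exists2 i : nat, (i < k)%N &
                        lambda = alpha`_i /\ (1 < m i)%N
                    | lambda \in lam],
                lchar_poly Tperp =
                  (\prod_(i < k) ('X - (alpha`_i)%:P) ^+ (m i - 1)) *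
                  \prod_(l <- lam) ('X - l%:P)
              & char_poly T =
                  'X * (\prod_(i < k) ('X - (alpha`_i)%:P) ^+ (m i - 1)) *
                  \prod_(l <- lam) ('X - l%:P)]]].
Proof.
move=> T Tperp alpha k m.
have [lam [lam_uniq lam_size lamP]] := secular_roots_enum n_gt0 Ld.
have lcharE : lchar_poly Tperp =
    (\prod_(i < k) ('X - (alpha`_i)%:P) ^+ (m i - 1)) *
    \prod_(l <- lam) ('X - l%:P).
  by apply: lchar_poly_rdop_perp => // x /lamP.
have charE : char_poly T =
    'X * (\prod_(i < k) ('X - (alpha`_i)%:P) ^+ (m i - 1)) *
    \prod_(l <- lam) ('X - l%:P).
  by rewrite -mulrA -lcharE char_poly_rdop.
split=> [|i ik|x _|].
- exact: rdop_ones.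
- by split=> [x|]; [exact: dev_space_eigenP | exact: dim_dev_space].
- exact: secular_devs.
exists lam; split=> //.
- split=> // x; split=> [/lamP xP|[x_eigen x_alpha]].
    have x_alpha := secular_root_notin xP; split=> //.
    exact: (leigenvalue_rdop_perpP n_gt0 x_alpha).2.
  exact/lamP/(leigenvalue_rdop_perpP n_gt0 x_alpha).1.
- by move=> x /lamP; exact: simple_eigenvalue_secular_root.
- move=> i ik; have [x xi xP] := secular_root_gap ik; exists x; split=> // y [yi yP].
  exact: secular_root_gap_unique n_gt0 ik xi xP yi yP.
split=> // x; rewrite rdop_eigenvalueP -/T charE !rootM root_prod_XsubC.
rewrite -orbA rootX; split.
  case/or3P => [/eqP->| |xlam]; [exact: Or31| |exact: Or33].
  rewrite /root horner_prod => /prodf_eq0[i _]; rewrite horner_exp expf_eq0 subn_gt0.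
  rewrite !hornerE subr_eq0 => /andP[mi /eqP->]; apply: Or32.
  by exists i.
case=> [->|[i ik [-> mi]]|->]; rewrite ?eqxx ?orbT //; apply/or3P/Or32.
rewrite /root horner_prod; apply/prodf_eq0; exists (Ordinal ik) => //=.
by rewrite horner_exp expf_eq0 subn_gt0 mi !hornerE subrr eqxx.
Qed.
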